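(* Let $T>0$, $A\in\mathbb{R}^{n\times n}$ and $B\in\mathbb{R}^{n\times m}$. Suppose that the linear system $\dot{x}=Ax+Bu$ is controllable, i.e., the columns of $B,AB,\dots,A^{n-1}B$ span $\mathbb{R}^n$. Let $$W(0,T):=\int_0^T e^{-A\tau}BB^{\mathsf T}e^{-A^{\mathsf T}\tau}\,d\tau ,$$ which is symmetric positive definite. Let $\psi:\mathbb{R}^n\to\mathbb{R}^n$ be an orientation-preserving diffeomorphism such that the mapping $\hat\psi:\mathbb{R}^n\to\mathbb{R}^n$, $$\hat\psi(x):=W(0,T)^{-1/2}\,e^{-AT}\,\psi\big(W(0,T)^{1/2}x\big),$$ is monotone. Then there exists a feedback control law $u(t,x)$ that steers the state of $\dot{x}=Ax+Bu$ from $x(0)=x_0$ to $x(T)=\psi(x_0)$ for every $x_0\in\mathbb{R}^n$.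
   Context: A mapping $\phi:\mathbb{R}^n\to\mathbb{R}^n$ is monotone if $\langle x-y,\phi(x)-\phi(y)\rangle\ge 0$ for all $x,y\in\mathbb{R}^n$. $W^{1/2}$ denotes the symmetric positive-definite square root of a symmetric positive-definite matrix $W$, and $W^{-1/2}$ its inverse. A feedback control law is a single function $u:[0,T]\times\mathbb{R}^n\to\mathbb{R}^m$, $(t,x)\mapsto u(t,x)$, of time and current state (not depending on the initial state). That it steers the state from $x(0)=x_0$ to $x(T)=\psi(x_0)$ for every $x_0$ means: for every $x_0\in\mathbb{R}^n$ there is a trajectory $x:[0,T]\to\mathbb{R}^n$ solving the closed-loop equation $\dot{x}(t)=Ax(t)+Bu(t,x(t))$ with $x(0)=x_0$ and $x(T)=\psi(x_0)$. *)

(* Defs.v *)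
From HB Require Import structures.
From mathcomp Require Import all_boot all_order all_algebra.
From mathcomp Require Import all_classical all_reals all_analysis.
Set Implicit Arguments.
Unset Strict Implicit.
Unset Printing Implicit Defensive.
Import Order.TTheory GRing.Theory Num.Theory.
Import numFieldNormedType.Exports.
Local Open Scope classical_set_scope.
Local Open Scope ring_scope.

Definition dotcv (R : realType) (n : nat) (x y : 'cV[R]_n) : R :=
  (x^T *m y) 0 0.

Definition monotone_map (R : realType) (n : nat)
    (phi : 'cV[R]_n -> 'cV[R]_n) : Prop :=
  forall x y, 0 <= dotcv (x - y) (phi x - phi y).

Definition sym_posdef (R : realType) (n : nat) (M : 'M[R]_n) : Prop :=
  M^T = M /\ forall x : 'cV[R]_n, x != 0 -> 0 < dotcv x (M *m x).

(* The symmetric positive-definite square root of [W], which exists and is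
   unique when [W] is symmetric positive definite; the value is 0 when there is
   no such root. *)
Definition sqrtmx (R : realType) (n : nat) (W : 'M[R]_n) : 'M[R]_n :=
  xget 0 [set S : 'M[R]_n | sym_posdef S /\ S *m S = W].

Definition expmx (R : realType) (n : nat) (A : 'M[R]_n) : 'M[R]_n :=
  lim (series (fun k : nat => (k`!%:R)^-1 *: A ^+ k) @ \oo).

Definition kalman_mx (R : realType) (n m : nat)
    (A : 'M[R]_n) (B : 'M[R]_(n, m)) :=
  \mxrow_(k < n) (A ^+ k *m B).

(* [row_full] of the transpose: the columns of the Kalman matrix span R^n. *)
Definition controllable (R : realType) (n m : nat)
    (A : 'M[R]_n) (B : 'M[R]_(n, m)) : Prop :=
  row_full (kalman_mx A B)^T.

Definition gramian (R : realType) (n m : nat)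
    (A : 'M[R]_n) (B : 'M[R]_(n, m)) (T : R) : 'M[R]_n :=
  \matrix_(i < n, j < n) \int[lebesgue_measure]_(tau in `[0, T])
    (expmx (- tau *: A) *m B *m B^T *m expmx (- tau *: A^T)) i j.

(* The library's [jacobian] is for row vectors and is the transpose of the
   usual one; this is the usual one, [D f x *m v = 'd f x v]. *)
Definition jacobian_cv (R : realType) (n : nat) (f : 'cV[R]_n -> 'cV[R]_n)
    (x : 'cV[R]_n) : 'M[R]_n :=
  \matrix_(i < n, j < n) ('d f x : 'cV[R]_n -> 'cV[R]_n) (delta_mx j 0) i 0.

Definition C1_map (R : realType) (n : nat) (f : 'cV[R]_n -> 'cV[R]_n) : Prop :=
  (forall x, differentiable f x) /\ continuous (jacobian_cv f).

(* Diffeomorphisms are of class C^1, the weakest of the usual conventions. *)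
Definition diffeomorphism (R : realType) (n : nat)
    (f : 'cV[R]_n -> 'cV[R]_n) : Prop :=
  C1_map f /\
  exists g : 'cV[R]_n -> 'cV[R]_n, [/\ cancel f g, cancel g f & C1_map g].

Definition orientation_preserving (R : realType) (n : nat)
    (f : 'cV[R]_n -> 'cV[R]_n) : Prop :=
  forall x, 0 < \det (jacobian_cv f x).

(* Derivative at [t] of a curve defined on [D]; it is one-sided when [t] is an
   end point of an interval [D], and it does not depend on the values of [x]
   outside [D]. *)
Definition has_derivative_on (R : realType) (n : nat) (D : set R)
    (x : R -> 'cV[R]_n) (t : R) (v : 'cV[R]_n) : Prop :=
  (s - t)^-1 *: (x s - x t) @[s --> within D t^'] --> v.

Definition closed_loop_trajectory (R : realType) (n m : nat) (T : R)
    (A : 'M[R]_n) (B : 'M[R]_(n, m)) (u : R -> 'cV[R]_n -> 'cV[R]_m)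
    (x : R -> 'cV[R]_n) : Prop :=
  forall t : R, t \in `[0, T] ->
    has_derivative_on `[0, T]%classic x t (A *m x t + B *m u t (x t)).

Definition feedback_steers (R : realType) (n m : nat) (T : R)
    (A : 'M[R]_n) (B : 'M[R]_(n, m)) (psi : 'cV[R]_n -> 'cV[R]_n)
    (u : R -> 'cV[R]_n -> 'cV[R]_m) : Prop :=
  forall x0 : 'cV[R]_n, exists x : R -> 'cV[R]_n,
    [/\ closed_loop_trajectory T A B u x, x 0 = x0 & x T = psi x0].

Definition psi_hat (R : realType) (n m : nat) (T : R)
    (A : 'M[R]_n) (B : 'M[R]_(n, m)) (psi : 'cV[R]_n -> 'cV[R]_n)
    (x : 'cV[R]_n) : 'cV[R]_n :=
  invmx (sqrtmx (gramian A B T)) *m expmx (- T *: A)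
    *m psi (sqrtmx (gramian A B T) *m x).

(* Main.v *)
Require Import Defs.
From mathcomp Require Import all_boot all_order all_algebra.
From mathcomp Require Import all_classical all_reals all_analysis.
From mathcomp Require Import complex ring lra.
Set Implicit Arguments.
Unset Strict Implicit.
Unset Printing Implicit Defensive.
Import Order.TTheory GRing.Theory Num.Theory.
Import numFieldNormedType.Exports.
Local Open Scope classical_set_scope.
Local Open Scope ring_scope.

(** The steering law is read off from the minimum-energy controls.  Write
    W(t) for the Gramian over [0, t], W = W(T) and y0 = e^{-AT} psi(x0).
    The open-loop control B^T e^{-A^T t} W^{-1} (y0 - x0) drives x0 to psi(x0)
    along
      phi_t(x0) = e^{At} (x0 + W(t) W^{-1} (y0 - x0)).
    If every phi_t with t in [0, T] is injective, the initial state can be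
    recovered from the pair (t, phi_t(x0)), so this control is a function of
    time and current state, that is, a feedback law.  The proof thus reduces to
    injectivity.

    Since W^{1/2} is symmetric, monotonicity of psi_hat says that
    <dx, W^{-1} dy> >= 0 for any two initial states, where dx and dy are the
    differences of the x0 and of the y0 (psi_hat_monotone_pairing).  Suppose
    that phi_t takes the same value twice, and put mu = W^{-1} dx and
    nu = W^{-1} dy.  Then (W - W(t)) mu = - W(t) nu, from which
      <dx, W^{-1} dy> = - <mu, (W - W(t)) mu> - <nu, W(t) nu>.
    Both terms on the right are nonpositive, because W(t) increases with t, so
    nu = 0 when t > 0 (displacement_eq0); then dy = 0, and psi being injective
    the two initial states agree.  At t = 0 the map phi_0 is the identity.

    Three ingredients are built up for this.  The square root of W, without
    which psi_hat would be degenerate, comes from the complex spectral theorem: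
    W is annihilated by every real polynomial vanishing at finitely many
    positive numbers (sym_posdef_spectrum), and interpolating a fourth root at
    these numbers gives a real symmetric matrix Q with W = (Q Q)^2.  The matrix
    exponential is studied through its entries, which are power series
    (is_derive_expmx).  Definiteness of W(t) under controllability follows by
    differentiating: if <x, W(t) x> = 0, then s |-> x^T e^{-As} B vanishes on
    ]0, t[ together with all its derivatives, that is, e^{-A^T s} x is
    orthogonal to the columns of every A^k B (partial_gramian_posdef). *)

(** * Symmetric positive definite matrices and their square root *)

Lemma dotcvE (R : realType) n (x y : 'cV[R]_n) : dotcv x y = \sum_i x i 0 * y i 0.
Proof. by rewrite /dotcv mxE; apply: eq_bigr => i _; rewrite mxE. Qed.

Lemma dotcv_ge0 (R : realType) n (x : 'cV[R]_n) : 0 <= dotcv x x.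
Proof. by rewrite dotcvE sumr_ge0// => i _; rewrite -expr2 sqr_ge0. Qed.

Lemma dotcv_eq0 (R : realType) n (x : 'cV[R]_n) : (dotcv x x == 0) = (x == 0).
Proof.
apply/eqP/eqP => [|->]; last by rewrite /dotcv mulmx0 mxE.
rewrite dotcvE => /eqP; rewrite psumr_eq0; last by move=> i _; rewrite -expr2 sqr_ge0.
move/allP => h; apply/matrixP => i j; rewrite ord1 mxE; apply/eqP.
by have := h i (mem_index_enum i); rewrite -expr2 sqrf_eq0.
Qed.

Lemma dotcv_mulmxl (R : realType) n p (M : 'M[R]_(p, n)) (x : 'cV[R]_n) (y : 'cV[R]_p) :
  dotcv (M *m x) y = dotcv x (M^T *m y).
Proof. by rewrite /dotcv trmx_mul mulmxA. Qed.

Lemma dotcvC (R : realType) n (x y : 'cV[R]_n) : dotcv x y = dotcv y x.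
Proof. by rewrite !dotcvE; apply: eq_bigr => i _; rewrite mulrC. Qed.

Lemma dotcvBr (R : realType) n (x y z : 'cV[R]_n) :
  dotcv x (y - z) = dotcv x y - dotcv x z.
Proof. by rewrite /dotcv mulmxBr !mxE. Qed.

Lemma sym_posdef_unit (R : realType) n (M : 'M[R]_n) :
  sym_posdef M -> M \in unitmx.
Proof.
move=> [Msym Mpos]; rewrite -row_free_unit -kermx_eq0.
apply: contraT => /rowV0Pn[v /sub_kermxP vM v0].
have := Mpos v^T; rewrite /dotcv trmxK mulmxA vM mul0mx mxE ltxx.
by rewrite -trmx0 (inj_eq (@trmx_inj _ _ _)) v0 => /(_ isT).
Qed.

Lemma interpolation (F : fieldType) (s : seq F) (f : F -> F) :
  exists p : {poly F}, forall x, x \in s -> p.[x] = f x.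
Proof.
elim: s => [|a s [p ps]]; first by exists 0.
have [ain|aNin] := boolP (a \in s).
  by exists p => x; rewrite in_cons => /orP[/eqP ->|]; exact: ps.
pose w := \prod_(b <- s) ('X - b%:P) : {poly F}.
have wa : w.[a] != 0 by rewrite -/(root w a) root_prod_XsubC.
exists (p + ((f a - p.[a]) / w.[a]) *: w) => x.
rewrite in_cons !hornerE => /predU1P[->|xs].
  by rewrite divfK// addrC subrK.
have /eqP -> : w.[x] == 0 by rewrite -/(root w x) root_prod_XsubC.
by rewrite mulr0 addr0 ps.
Qed.

(** The numbers are the eigenvalues of [W].  They are real because the
    complexification of [W] is Hermitian; the real or the imaginary part of a
    complex eigenvector is a nonzero real eigenvector, so they are positive.
    The conclusion only speaks of real polynomials in [W]: in this way the
    unitary diagonalisation, which lives over the complex numbers, never has to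
    be made real. *)
Lemma sym_posdef_spectrum (R : realType) n (W : 'M[R]_n.+1) : sym_posdef W ->
  exists2 s : seq R, {in s, forall a, 0 < a} &
    forall p : {poly R}, {in s, forall a, p.[a] = 0} -> horner_mx W p = 0.
Proof.
move=> [Wsym Wpos].
pose iota := real_complex R.
pose C := R[i].
pose WC : 'M[C]_n.+1 := map_mx iota W.
have WCsym : WC \is symmetricmx.
  by apply/is_hermitianmxP; rewrite expr0 scale1r map_mx_id// map_trmx Wsym.
have WCreal : WC \is a mxOver Num.real.
  by apply/mxOverP => i j; rewrite mxE; apply/complex_realP; exists (W i j).
have WCherm := realsym_hermsym WCsym WCreal.
have Dreal := hermitian_spectral_diag_real WCherm.
have /orthomx_spectralP := hermitian_normalmx WCherm.
have := spectral_unit WC.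
set P := spectralmx WC; set D := spectral_diag WC => Punit WCE.
pose lam i := complex.Re (D 0 i).
have lamE i : D 0 i = iota (lam i).
  have /mxOverP/(_ 0 i)/complex_realP[k Dk] := Dreal.
  by rewrite /lam Dk.
exists [seq lam i | i : 'I_n.+1].
  move=> _ /mapP[i _ ->].
  have PW : row i P *m WC = D 0 i *: row i P.
    by rewrite -row_mul [in LHS]WCE !mulmxA mulmxV// mul1mx row_mul row_diag_mx
      -scalemxAl -rowE.
  have row_ri (h : {additive C -> R}) : (forall a b, h (a * iota b) = h a * b) ->
      (map_mx h (row i P)) *m W = lam i *: map_mx h (row i P).
    move=> hM; apply/rowP => j; have /rowP/(_ j) := PW.
    rewrite !mxE lamE => /(congr1 h); rewrite mulrC hM mulrC => <-.
    by rewrite raddf_sum; apply: eq_bigr => k _; rewrite !mxE hM.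
  (* [h] will be the real part or the imaginary part. *)
  have step (h : {additive C -> R}) : (forall a b, h (a * iota b) = h a * b) ->
      map_mx h (row i P) != 0 -> 0 < lam i.
    move=> hM h0; have := Wpos (map_mx h (row i P))^T.
    rewrite -trmx0 (inj_eq (@trmx_inj _ _ _)) h0 => /(_ isT).
    rewrite /dotcv trmxK mulmxA row_ri// -scalemxAl mxE.
    rewrite pmulr_lgt0 // lt_neqAle; set x := map_mx _ _.
    have -> : (x *m x^T) 0 0 = dotcv x^T x^T by rewrite /dotcv trmxK.
    by rewrite dotcv_ge0 eq_sym dotcv_eq0 -trmx0 (inj_eq (@trmx_inj _ _ _)) h0.
  have [Re0|] := eqVneq (map_mx (@complex.Re R) (row i P)) 0; last first.
    by apply: step => -[a a'] b; rewrite /= mulr0 subr0.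
  have [Im0|] := eqVneq (map_mx (@complex.Im R) (row i P)) 0; last first.
    by apply: step => -[a a'] b; rewrite /= mulr0 add0r.
  have : row i P == 0.
    apply/eqP/rowP => j; move/rowP/(_ j): Re0; move/rowP/(_ j): Im0.
    by rewrite !mxE; case: (P i j) => /= a b -> ->.
  have /row_freeP[Q PQ] : row_free P by rewrite row_free_unit.
  move/eqP => /(congr1 (mulmx^~ Q)); rewrite -row_mul PQ mul0mx.
  by move/rowP/(_ i)/eqP; rewrite !mxE eqxx oner_eq0.
move=> p p0; apply: (map_mx_inj (f := real_complex R)).
rewrite map_mx0 map_horner_mx -/WC WCE horner_mx_uconjC//.
have -> : horner_mx (diag_mx D) (map_poly (real_complex R) p) = 0; last first.
  by rewrite mulmx0 mul0mx.
rewrite horner_mx_diag -(raddf0 (@diag_mx C n.+1)); congr diag_mx.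
apply/rowP => i; rewrite !mxE lamE horner_map.
by rewrite p0 ?rmorph0//; apply/mapP; exists i; rewrite ?mem_enum.
Qed.

Lemma tr_horner_mx (R : comNzRingType) n (M : 'M[R]_n.+1) (p : {poly R}) :
  (horner_mx M p)^T = horner_mx M^T p.
Proof.
elim/poly_ind: p => [|p c IH]; first by rewrite !rmorph0 trmx0.
rewrite !rmorphD !rmorphM/= !horner_mx_C !horner_mx_X linearD/= tr_scalar_mx.
rewrite trmx_mul IH; congr (_ + _).
by apply/comm_mx_horner/comm_mx_refl.
Qed.

Lemma sym_posdef_gram (R : realType) n (Q : 'M[R]_n) :
  Q \in unitmx -> sym_posdef (Q^T *m Q).
Proof.
move=> Qu; split=> [|x x0]; first by rewrite trmx_mul trmxK.
rewrite dotcvC -mulmxA dotcv_mulmxl trmxK lt_neqAle dotcv_ge0 andbT eq_sym.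
rewrite dotcv_eq0; apply: contraNneq x0 => /(congr1 (mulmx (invmx Q))).
by rewrite mulKmx// mulmx0 => ->.
Qed.

(** The root is built as a square [Q *m Q] with [Q] symmetric and invertible,
    where [Q] takes fourth roots of the eigenvalues: positivity of the root is
    then automatic. *)
Lemma ex_sqrtmx (R : realType) n (W : 'M[R]_n) : sym_posdef W ->
  exists S, sym_posdef S /\ S *m S = W.
Proof.
case: n W => [|n] W Wpd.
  by exists W; split=> //; apply/matrixP => -[].
have [s s0 sW] := sym_posdef_spectrum Wpd.
have [q qE] := interpolation s (fun a => Num.sqrt (Num.sqrt a)).
pose Q := horner_mx W q.
have QQ : Q *m Q *m (Q *m Q) = W.
  have -> : Q *m Q *m (Q *m Q) = horner_mx W (q * q * (q * q)) by rewrite !rmorphM.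
  rewrite -[RHS]horner_mx_X; apply/eqP; rewrite -subr_eq0 -rmorphB.
  apply/eqP/sW => a sa; have /ltW a0 := s0 _ sa.
  have r4 : q.[a] * q.[a] * (q.[a] * q.[a]) = a.
    by rewrite qE// -!expr2 !sqr_sqrtr ?sqrtr_ge0.
  by rewrite !(hornerD, hornerN, hornerM, hornerX) r4 subrr.
have Qsym : Q^T = Q by rewrite tr_horner_mx Wpd.1.
have Qu : Q \in unitmx.
  by have := sym_posdef_unit Wpd; rewrite -QQ !unitmx_mul => /andP[/andP[]].
by exists (Q *m Q); split=> //; rewrite -{1}Qsym; exact: sym_posdef_gram.
Qed.

(** Existence of a root rules out the default value in the definition of
    [sqrtmx]. *)
Lemma sqrtmxP (R : realType) n (W : 'M[R]_n) : sym_posdef W ->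
  sym_posdef (sqrtmx W) /\ sqrtmx W *m sqrtmx W = W.
Proof.
move=> /ex_sqrtmx SW.
exact: (@xgetPex _ 0 [set S : 'M[R]_n | sym_posdef S /\ S *m S = W]).
Qed.

(** * Matrix-valued curves, entry by entry *)

Lemma cvg_mx (R : realType) (I : Type) (F : set_system I) (FF : Filter F) p q
    (M : I -> 'M[R]_(p, q)) (L : 'M[R]_(p, q)) :
  (forall i j, M s i j @[s --> F] --> L i j) -> M s @[s --> F] --> L.
Proof.
move=> ML A [P LP PA]; apply: filterS (_ : F [set s | forall i j, P i j (M s i j)]).
  by move=> s /=; exact: PA.
apply: filter_forall => i; apply: filter_forall => j; exact: ML (LP i j).
Qed.

Lemma cvg_coord (R : realType) (I : Type) (F : set_system I) (FF : Filter F) p q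
    (M : I -> 'M[R]_(p, q)) (L : 'M[R]_(p, q)) i j :
  M s @[s --> F] --> L -> M s i j @[s --> F] --> L i j.
Proof.
move=> ML; apply: (@cvg_comp _ _ _ M (fun N : 'M[R]_(p, q) => N i j) _ _ _ ML).
exact: coord_continuous.
Qed.

Lemma cvg_sumr (R : realType) (I J : Type) (F : set_system I) (FF : Filter F)
    (r : seq J) (f : J -> I -> R) (l : J -> R) :
  (forall k, f k s @[s --> F] --> l k) ->
  (\sum_(k <- r) f k s) @[s --> F] --> \sum_(k <- r) l k.
Proof.
move=> fl; elim: r => [|k r IH].
  by rewrite big_nil; under eq_fun do rewrite big_nil; exact: cvg_cst.
by rewrite big_cons; under eq_fun do rewrite big_cons; exact: cvgD.
Qed.

Lemma cvg_mulmx (R : realType) (I : Type) (F : set_system I) (FF : Filter F) p q r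
    (M : I -> 'M[R]_(p, q)) (N : I -> 'M[R]_(q, r))
    (L : 'M[R]_(p, q)) (K : 'M[R]_(q, r)) :
  M s @[s --> F] --> L -> N s @[s --> F] --> K ->
  M s *m N s @[s --> F] --> L *m K.
Proof.
move=> ML NK; apply: cvg_mx => i j; rewrite mxE; under eq_fun do rewrite mxE.
by apply: cvg_sumr => k; apply: cvgM; exact: cvg_coord.
Qed.

Lemma is_derive_mxP (R : realType) p q (M : R -> 'M[R]_(p, q))
    (t : R) (D : 'M[R]_(p, q)) :
  is_derive t (1 : R) M D <->
  forall i j, is_derive t (1 : R) (fun s => M s i j) (D i j).
Proof.
split=> [[dM <-] i j|dM].
  by apply: DeriveDef; [exact: (derivable_mxP _ _ _).1 | rewrite derive_mx// mxE].
have dv : derivable M t 1 by apply/derivable_mxP => i j; have [] := dM i j.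
apply: DeriveDef => //; rewrite derive_mx//; apply/matrixP => i j; rewrite mxE.
by have [] := dM i j.
Qed.

Lemma is_derive_mulmx (R : realType) p q r (M : R -> 'M[R]_(p, q))
    (N : R -> 'M[R]_(q, r)) (t : R) (dM : 'M[R]_(p, q)) (dN : 'M[R]_(q, r)) :
  is_derive t (1 : R) M dM -> is_derive t (1 : R) N dN ->
  is_derive t (1 : R) (fun s => M s *m N s) (dM *m N t + M t *m dN).
Proof.
move=> /is_derive_mxP dMt /is_derive_mxP dNt; apply/is_derive_mxP => i j.
have -> : (fun s => (M s *m N s) i j) =
    \sum_(k < q) ((fun s => M s i k) * (fun s => N s k j)).
  by apply/funext => s; rewrite mxE fct_sumE.
apply: is_derive_eq.
rewrite !mxE -big_split/=; apply: eq_bigr => k _.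
by rewrite addrC; congr (_ + _); exact: mulrC.
Qed.

Lemma is_derive_cstmx (R : realType) p q (M : 'M[R]_(p, q)) (t : R) :
  is_derive t (1 : R) (fun _ : R => M) 0.
Proof. exact: is_derive_cst. Qed.

Lemma is_derive_mulmxr (R : realType) p q r (M : R -> 'M[R]_(p, q))
    (N : 'M[R]_(q, r)) (t : R) (dM : 'M[R]_(p, q)) :
  is_derive t (1 : R) M dM -> is_derive t (1 : R) (fun s => M s *m N) (dM *m N).
Proof.
move=> dMt; apply: is_derive_eq.
  exact: is_derive_mulmx dMt (is_derive_cstmx N t).
by rewrite mulmx0 addr0.
Qed.

Lemma is_derive_mulmxl (R : realType) p q r (M : 'M[R]_(p, q))
    (N : R -> 'M[R]_(q, r)) (t : R) (dN : 'M[R]_(q, r)) :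
  is_derive t (1 : R) N dN -> is_derive t (1 : R) (fun s => M *m N s) (M *m dN).
Proof.
move=> dNt; apply: is_derive_eq.
  exact: is_derive_mulmx (is_derive_cstmx M t) dNt.
by rewrite mul0mx add0r.
Qed.

Lemma is_derive_continuous (R : realType) (V : normedModType R)
    (f : R -> V) (t : R) (d : V) :
  is_derive t (1 : R) f d -> {for t, continuous f}.
Proof. by move=> [df _]; apply: differentiable_continuous; exact/derivable1_diffP. Qed.

Lemma is_derive_has_derivative_on (R : realType) n (D : set R)
    (x : R -> 'cV[R]_n) (t : R) (v : 'cV[R]_n) :
  is_derive t (1 : R) x v -> has_derivative_on D x t v.
Proof.
move=> [/cvg_ex[l xl] xv].
have lv : l = v by rewrite -xv; exact/esym/cvg_lim.
apply: cvg_within_filter; rewrite -{}lv; apply/cvgrPdist_le => e e0.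
move/cvgrPdist_le : xl => /(_ e e0)[/= r r0 rx].
exists r => //= s; rewrite /ball_/= => str st.
have := rx (s - t); rewrite /ball_/= sub0r opprB str => /(_ isT).
by rewrite subr_eq0 st => /(_ isT); rewrite [_%:A]mulr1 subrK.
Qed.

(** * The matrix exponential *)

(** The coefficients of the power series in [t] of the entries of
    [expmx (t *: A) *m M].  The factor [M] makes the family stable under
    termwise differentiation, which replaces [M] by [A *m M]. *)
Definition expmx_coef (R : realType) n r (A : 'M[R]_n) (M : 'M[R]_(n, r))
    i j (k : nat) : R :=
  (k`!%:R)^-1 * (A ^+ k *m M) i j.

Lemma pseries_diffs_expmx_coef (R : realType) n r (A : 'M[R]_n) (M : 'M[R]_(n, r)) i j :
  pseries_diffs (expmx_coef A M i j) = expmx_coef A (A *m M) i j.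
Proof.
apply/funext => k; rewrite /pseries_diffs /expmx_coef factS natrM invfM.
by rewrite mulrA mulVKf ?pnatr_eq0// mulmxA exprSr.
Qed.

(** The constants are the sums of the absolute values of the entries of [A] and
    of [M]; this norm is submultiplicative. *)
Lemma expmx_coef_le (R : realType) n r (A : 'M[R]_n) (M : 'M[R]_(n, r)) :
  exists a b : R, [/\ 0 <= a, 0 <= b &
    forall i j k, `|(A ^+ k *m M) i j| <= a ^+ k * b].
Proof.
pose nrm p q (N : 'M[R]_(p, q)) := \sum_i \sum_j `|N i j|.
have nrm0 p q (N : 'M[R]_(p, q)) : 0 <= nrm p q N.
  by apply: sumr_ge0 => i _; exact: sumr_ge0.
exists (nrm _ _ A), (nrm _ _ M); split=> // i j k.
have row_le p q (N : 'M[R]_(p, q)) i' : \sum_j `|N i' j| <= nrm _ _ N.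
  by rewrite /nrm (bigD1 i')//= lerDl sumr_ge0// => ? _; exact: sumr_ge0.
elim: k i => [|k IH] i.
  rewrite expr0 mul1mx mul1r; apply: le_trans (row_le _ _ M i).
  by rewrite (bigD1 j)//= lerDl sumr_ge0.
rewrite exprS -mulmxA mxE (le_trans (ler_norm_sum _ _ _))//.
rewrite (@le_trans _ _ (\sum_l `|A i l| * (nrm _ _ A ^+ k * nrm _ _ M)))//.
  by apply: ler_sum => l _; rewrite normrM ler_wpM2l.
by rewrite -mulr_suml exprS -mulrA ler_wpM2r// mulr_ge0// exprn_ge0.
Qed.

Lemma is_cvg_pseries_expmx (R : realType) n r (A : 'M[R]_n) (M : 'M[R]_(n, r)) i j t :
  cvgn (pseries (expmx_coef A M i j) t).
Proof.
have [a [b [a0 b0 ab]]] := expmx_coef_le A M.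
apply: normed_cvg.
apply: (@series_le_cvg _ _ (fun k => b * exp_coeff (a * `|t|) k)).
- by move=> k; exact: normr_ge0.
- by move=> k; rewrite mulr_ge0// divr_ge0// exprn_ge0// mulr_ge0.
- move=> k; rewrite /expmx_coef /exp_coeff/= !normrM normrX normfV normr_nat.
  rewrite exprMn [leRHS](_ : _ = k`!%:R^-1 * (a ^+ k * b) * `|t| ^+ k).
    by rewrite ler_wpM2r ?exprn_ge0// ler_wpM2l.
  by set c := _^-1; ring.
- exact/is_cvg_seriesZ/is_cvg_series_exp_coeff.
Qed.

Lemma exprZmx (R : comNzRingType) n (A : 'M[R]_n) (t : R) k :
  (t *: A) ^+ k = t ^+ k *: A ^+ k.
Proof.
elim: k => [|k IH]; first by rewrite !expr0 scale1r.
by rewrite !exprS IH -[LHS]/((t *: A) *m _) -scalemxAl -scalemxAr scalerA.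
Qed.

Definition expmx_series (R : realType) n (A : 'M[R]_n) : nat -> 'M[R]_n :=
  series (fun k : nat => (k`!%:R)^-1 *: A ^+ k).

Lemma expmx_seriesE (R : realType) n r (A : 'M[R]_n) (M : 'M[R]_(n, r)) t N i j :
  (expmx_series (t *: A) N *m M) i j = pseries (expmx_coef A M i j) t N.
Proof.
rewrite /expmx_series /pseries /series/= mulmx_suml summxE; apply: eq_bigr => k _.
by rewrite exprZmx scalerA -scalemxAl mxE /expmx_coef mulrAC.
Qed.

Lemma cvg_expmx_series (R : realType) n (A : 'M[R]_n) (t : R) :
  expmx_series (t *: A) @ \oo --> expmx (t *: A).
Proof.
suff : cvgn (expmx_series (t *: A)) by [].
apply/cvg_ex; exists (\matrix_(i, j) limn (pseries (expmx_coef A 1%:M i j) t)).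
apply: cvg_mx => i j; rewrite mxE.
have -> : (fun N => expmx_series (t *: A) N i j) = pseries (expmx_coef A 1%:M i j) t.
  by apply/funext => N; rewrite -expmx_seriesE mulmx1.
exact: is_cvg_pseries_expmx.
Qed.

Lemma expmx_mulE (R : realType) n r (A : 'M[R]_n) (M : 'M[R]_(n, r)) (t : R) i j :
  (expmx (t *: A) *m M) i j = limn (pseries (expmx_coef A M i j) t).
Proof.
apply/esym/cvg_lim => //.
have -> : pseries (expmx_coef A M i j) t = (fun N => (expmx_series (t *: A) N *m M) i j).
  by apply/funext => N; rewrite expmx_seriesE.
apply: cvg_coord; apply: cvg_mulmx; [exact: cvg_expmx_series | exact: cvg_cst].
Qed.

Lemma expmxE (R : realType) n (A : 'M[R]_n) (t : R) i j :
  expmx (t *: A) i j = limn (pseries (expmx_coef A 1%:M i j) t).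
Proof. by rewrite -[expmx _]mulmx1 expmx_mulE. Qed.

Lemma comm_expmx (R : realType) n (A : 'M[R]_n) (t : R) :
  A *m expmx (t *: A) = expmx (t *: A) *m A.
Proof.
have AE : A *m expmx_series (t *: A) N @[N --> \oo] --> A *m expmx (t *: A).
  by apply: cvg_mulmx; [exact: cvg_cst | exact: cvg_expmx_series].
have EA : expmx_series (t *: A) N *m A @[N --> \oo] --> expmx (t *: A) *m A.
  by apply: cvg_mulmx; [exact: cvg_expmx_series | exact: cvg_cst].
apply: cvg_unique AE _ => //.
suff -> : (fun N => A *m expmx_series (t *: A) N) =
    (fun N => expmx_series (t *: A) N *m A).
  exact: EA.
apply/funext => N; rewrite /expmx_series /series/= mulmx_suml mulmx_sumr.
apply: eq_bigr => k _; rewrite exprZmx scalerA -scalemxAl -scalemxAr.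
by congr (_ *: _); exact: (commrX k (commr_refl A)).
Qed.

(** Termwise differentiation of the power series of each entry.  The theorem on
    power series asks for convergence at a point [`|t| + 1] beyond [t] of the
    series and of its first two derived series. *)
Lemma is_derive_expmx (R : realType) n (A : 'M[R]_n) (t : R) :
  is_derive t (1 : R) (fun s => expmx (s *: A)) (expmx (t *: A) *m A).
Proof.
apply/is_derive_mxP => i j; rewrite expmx_mulE.
under eq_fun do rewrite expmxE.
have -> : expmx_coef A A i j = pseries_diffs (expmx_coef A 1%:M i j).
  by rewrite pseries_diffs_expmx_coef mulmx1.
apply: (@pseries_snd_diffs _ _ (`|t| + 1)).
- exact: is_cvg_pseries_expmx.
- by rewrite pseries_diffs_expmx_coef; exact: is_cvg_pseries_expmx.
- by rewrite !pseries_diffs_expmx_coef; exact: is_cvg_pseries_expmx.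
- by rewrite [ltRHS]ger0_norm ?addr_ge0// ltrDl.
Qed.

Lemma expmx0 (R : realType) n : expmx (0 : 'M[R]_n) = 1%:M.
Proof.
rewrite /expmx; apply: cvg_lim => //.
apply: cvg_near_cst; exists 1%N => //= N /= N0.
rewrite /series/= big_ltn// expr0 invr1 scale1r big1_seq ?addr0// => k.
rewrite mem_index_iota => /andP[_ /andP[k0 _]].
by case: k k0 => // k _; rewrite exprS [0 * _]mul0mx scaler0.
Qed.

Lemma is_derive_expmxN (R : realType) n (A : 'M[R]_n) (t : R) :
  is_derive t (1 : R) (fun s => expmx (- s *: A)) (- (expmx (- t *: A) *m A)).
Proof.
have -> : (fun s : R => expmx (- s *: A)) = (fun s => expmx (s *: - A)).
  by apply/funext => s; rewrite scaleNr scalerN.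
apply: is_derive_eq; first exact: is_derive_expmx.
by rewrite mulmxN scaleNr scalerN.
Qed.

(** The derivative of the product vanishes, since [A] commutes with its
    exponential, and the product is [1] at [t = 0]. *)
Lemma expmxNK (R : realType) n (A : 'M[R]_n) (t : R) :
  expmx (t *: A) *m expmx (- t *: A) = 1%:M.
Proof.
have dG s : is_derive s (1 : R) (fun s => expmx (s *: A) *m expmx (- s *: A)) 0.
  apply: is_derive_eq.
    exact: is_derive_mulmx (is_derive_expmx A s) (is_derive_expmxN A s).
  rewrite mulmxN -mulmxA; apply/eqP; rewrite subr_eq0; apply/eqP; congr (_ *m _).
  exact: comm_expmx.
apply/matrixP => i j.
transitivity ((expmx (0 *: A) *m expmx (- 0 *: A)) i j); last first.
  by rewrite oppr0 scale0r expmx0 mulmx1.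
apply: (@is_derive_0_is_cst _ (fun s => (expmx (s *: A) *m expmx (- s *: A)) i j)) => s.
by have /is_derive_mxP/(_ i j) := dG s; rewrite mxE.
Qed.

Lemma expmx_unit (R : realType) n (A : 'M[R]_n) (t : R) : expmx (t *: A) \in unitmx.
Proof. by have /mulmx1_unit[] := expmxNK A t. Qed.

Lemma expmxZ_tr (R : realType) n (A : 'M[R]_n) (t : R) :
  (expmx (t *: A))^T = expmx (t *: A^T).
Proof.
apply/matrixP => i j; rewrite mxE !expmxE; congr (limn (pseries _ _)).
apply/funext => k; rewrite /expmx_coef !mulmx1; congr (_ * _).
have -> : A^T ^+ k = (A ^+ k)^T; last by rewrite mxE.
elim: k => [|k IH]; first by rewrite !expr0 trmx1.
by rewrite exprSr exprS IH; exact/esym/trmx_mul.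
Qed.

(** * The controllability Gramian *)

(** Integrating from [-1] rather than from [0] gives a function that is
    differentiable on both sides at [0], so that both end points of the time
    interval can be treated like interior points. *)
Definition primitive (R : realType) (f : R -> R) (t : R) : R :=
  \int[lebesgue_measure]_(s in `[-1, t]) f s - \int[lebesgue_measure]_(s in `[-1, 0]) f s.

Lemma primitive0 (R : realType) (f : R -> R) : primitive f 0 = 0.
Proof. exact: subrr. Qed.

Lemma is_derive_primitive (R : realType) (f : R -> R) (t : R) :
  continuous f -> -1 < t -> is_derive t (1 : R) (primitive f) (f t).
Proof.
move=> cf t1.
have fint : lebesgue_measure.-integrable `[-1, t + 1] (EFin \o f).
  apply: continuous_compact_integrable; first exact: segment_compact.
  exact: continuous_subspaceT.
have tt1 : t < t + 1 by rewrite ltrDl.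
have [dF F'] := continuous_FTC1_closed tt1 fint t1 (cf t).
rewrite -[f t]subr0; apply: is_deriveB.
by apply: DeriveDef => //; rewrite -derive1E.
Qed.

Lemma primitive_integral (R : realType) (f : R -> R) (T : R) :
  continuous f -> 0 < T ->
  \int[lebesgue_measure]_(s in `[0, T]) f s = primitive f T.
Proof.
move=> cf T0.
have dF (t : R) : -1 < t -> is_derive t (1 : R) (primitive f) (f t).
  exact: is_derive_primitive.
have cF (t : R) : -1 < t -> {for t, continuous (primitive f)}.
  by move=> /dF/is_derive_continuous.
rewrite /Rintegral (@continuous_FTC2 _ f (primitive f))//=.
- by rewrite primitive0 subr0.
- exact: continuous_subspaceT.
- split.
  + move=> t; rewrite in_itv/= => /andP[t0 _].
    by have [] := dF t (lt_trans _ t0).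
  + by apply: cvg_at_right_filter; exact: cF.
  + by apply: cvg_at_left_filter; apply: cF; exact: lt_trans T0.
- move=> t; rewrite in_itv/= => /andP[t0 _].
  by rewrite derive1E; have [] := dF t (lt_trans _ t0).
Qed.

Definition gramian_integrand (R : realType) n m (A : 'M[R]_n) (B : 'M[R]_(n, m))
    (s : R) : 'M[R]_n :=
  expmx (- s *: A) *m B *m B^T *m expmx (- s *: A^T).

Lemma gramian_integrandE (R : realType) n m (A : 'M[R]_n) (B : 'M[R]_(n, m))
    (s : R) :
  gramian_integrand A B s = (expmx (- s *: A) *m B) *m (expmx (- s *: A) *m B)^T.
Proof. by rewrite trmx_mul expmxZ_tr mulmxA. Qed.

Lemma continuous_gramian_integrand (R : realType) n m (A : 'M[R]_n) (B : 'M[R]_(n, m))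
    i j :
  continuous (fun s => gramian_integrand A B s i j).
Proof.
move=> t; apply: cvg_coord.
apply: cvg_mulmx; last exact: is_derive_continuous (is_derive_expmxN _ _).
apply: cvg_mulmx; last exact: cvg_cst.
apply: cvg_mulmx; last exact: cvg_cst.
exact: is_derive_continuous (is_derive_expmxN _ _).
Qed.

Definition partial_gramian (R : realType) n m (A : 'M[R]_n) (B : 'M[R]_(n, m))
    (t : R) : 'M[R]_n :=
  \matrix_(i, j) primitive (fun s => gramian_integrand A B s i j) t.

Lemma partial_gramian0 (R : realType) n m (A : 'M[R]_n) (B : 'M[R]_(n, m)) :
  partial_gramian A B 0 = 0.
Proof. by apply/matrixP => i j; rewrite !mxE primitive0. Qed.

Lemma partial_gramianT (R : realType) n m (A : 'M[R]_n) (B : 'M[R]_(n, m))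
    (T : R) :
  0 < T -> partial_gramian A B T = gramian A B T.
Proof.
move=> T0; apply/matrixP => i j; rewrite !mxE -primitive_integral//.
exact: continuous_gramian_integrand.
Qed.

Lemma partial_gramian_sym (R : realType) n m (A : 'M[R]_n) (B : 'M[R]_(n, m))
    (t : R) :
  (partial_gramian A B t)^T = partial_gramian A B t.
Proof.
apply/matrixP => i j; rewrite !mxE; congr (primitive _ t); apply/funext => s.
have KT : (gramian_integrand A B s)^T = gramian_integrand A B s.
  by rewrite gramian_integrandE trmx_mul trmxK.
by rewrite -[in RHS]KT [RHS]mxE.
Qed.

Lemma is_derive_partial_gramian (R : realType) n m (A : 'M[R]_n) (B : 'M[R]_(n, m))
    (t : R) :
  -1 < t -> is_derive t (1 : R) (partial_gramian A B) (gramian_integrand A B t).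
Proof.
move=> t1; apply/is_derive_mxP => i j.
have -> : (fun s => partial_gramian A B s i j) =
    primitive (fun s => gramian_integrand A B s i j).
  by apply/funext => s; rewrite mxE.
by apply: is_derive_primitive t1; exact: continuous_gramian_integrand.
Qed.

Section quadratic_form.
Context (R : realType) (n m : nat) (A : 'M[R]_n) (B : 'M[R]_(n, m)) (x : 'cV[R]_n).

Let q (t : R) := dotcv x (partial_gramian A B t *m x).
Let w (t : R) := (expmx (- t *: A) *m B)^T *m x.

Lemma is_derive_gramian_form (t : R) : -1 < t -> is_derive t (1 : R) q (dotcv (w t) (w t)).
Proof.
move=> t1.
have /is_derive_mxP/(_ 0 0) := is_derive_mulmxl x^T
  (is_derive_mulmxr x (is_derive_partial_gramian A B t1)).
by rewrite gramian_integrandE {1}/w dotcv_mulmxl trmxK /w !mulmxA /dotcv !mulmxA.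
Qed.

Lemma gramian_form_homo (s t : R) : 0 <= s -> s <= t -> q s <= q t.
Proof.
move=> s0; rewrite le_eqVlt => /predU1P[->//|st].
have pos u : s <= u -> -1 < u.
  by move=> su; rewrite (lt_le_trans _ (le_trans s0 su))// ltrN10.
apply: (@ger0_derive1_le_cc _ q s t).
- move=> u; rewrite in_itv/= => /andP[/ltW su _].
  by have [] := is_derive_gramian_form (pos _ su).
- move=> u; rewrite in_itv/= => /andP[/ltW su _].
  by rewrite derive1E; have [_ ->] := is_derive_gramian_form (pos _ su); exact: dotcv_ge0.
- apply: derivable_within_continuous => u; rewrite in_itv/= => /andP[su _].
  by have [] := is_derive_gramian_form (pos _ su).
- by rewrite in_itv/= lexx ltW.
- by rewrite in_itv/= lexx ltW.
- exact: ltW.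
Qed.

(** The quadratic form starts from [0] and does not decrease; if it has not become
    positive at time [t], it is constant on the interval and its derivative, the
    square of the norm of [w], vanishes inside. *)
Lemma gramian_form_eq0 (t : R) : 0 < t -> q t <= 0 ->
  forall s, 0 < s < t -> w s = 0.
Proof.
move=> t0 qt s /andP[s0 st].
have q0 : q 0 = 0 by rewrite /q partial_gramian0 mul0mx /dotcv mulmx0 mxE.
have qs u : 0 <= u -> u <= t -> q u = 0.
  move=> u0 ut; apply/eqP; rewrite eq_le (le_trans (gramian_form_homo u0 ut))//=.
  by rewrite -[leLHS]q0 gramian_form_homo.
have s1 : -1 < s by exact: lt_trans s0.
apply/eqP; rewrite -dotcv_eq0; have [_ <-] := is_derive_gramian_form s1.
rewrite (@near_eq_derive _ _ _ _ (cst 0)) ?derive_cst//.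
near=> u; apply: qs; apply: ltW; near: u; [exact: lt_nbhsr | exact: lt_nbhsl].
Unshelve. all: by end_near. Qed.

End quadratic_form.

(** A vector orthogonal to the columns of all [A ^+ k *m B] lies in the kernel of
    the transposed Kalman matrix, which has full column rank. *)
Lemma controllable_inj (R : realType) n m (A : 'M[R]_n) (B : 'M[R]_(n, m))
    (y : 'cV[R]_n) :
  controllable A B -> (forall k, y^T *m (A ^+ k *m B) = 0) -> y = 0.
Proof.
move=> /row_fullP[K KE] yAB; rewrite -[y]mul1mx -KE -mulmxA.
have -> : (kalman_mx A B)^T *m y = (y^T *m kalman_mx A B)^T by rewrite trmx_mul trmxK.
rewrite mul_mxrow; under eq_mxrow do rewrite yAB.
by rewrite mxrow0 trmx0 mulmx0.
Qed.

(** Induction on [k]: differentiating [x^T *m expmx (- s *: A) *m A ^+ k *m B]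
    in [s] brings down one more factor [- A], and a function that vanishes on an
    open interval has zero derivative there. *)
Lemma expmx_moment0 (R : realType) n m (A : 'M[R]_n) (B : 'M[R]_(n, m))
    (x : 'cV[R]_n) (t : R) :
  (forall s, 0 < s < t -> (expmx (- s *: A) *m B)^T *m x = 0) ->
  forall k s, 0 < s < t -> x^T *m expmx (- s *: A) *m (A ^+ k *m B) = 0.
Proof.
move=> x0; elim=> [|k IH] s st.
  apply: trmx_inj; rewrite expr0 mul1mx trmx0 -mulmxA trmx_mul trmxK.
  exact: x0.
have df : is_derive s (1 : R) (fun s => x^T *m expmx (- s *: A) *m (A ^+ k *m B))
    (- (x^T *m expmx (- s *: A) *m (A ^+ k.+1 *m B))).
  apply: is_derive_eq.
    exact: is_derive_mulmxr (is_derive_mulmxl _ (is_derive_expmxN _ _)).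
  by rewrite exprS mulmxN mulNmx !mulmxA.
apply/eqP; rewrite -oppr_eq0; apply/eqP; have [_ <-] := df.
rewrite (@near_eq_derive _ _ _ _ (cst 0)) ?derive_cst//.
move/andP: st => [s0 st].
by near=> u; apply: IH; apply/andP; split; near: u; [exact: lt_nbhsr | exact: lt_nbhsl].
Unshelve. all: by end_near. Qed.

(** If the form is not positive at [x], the products with all
    [A ^+ k *m B] of its transported copies [(expmx (- s *: A))^T *m x] vanish
    between [0] and [t]; at the midpoint this makes the copy orthogonal to the
    columns of the Kalman matrix, hence zero. *)
Lemma partial_gramian_posdef (R : realType) n m (A : 'M[R]_n) (B : 'M[R]_(n, m))
    (t : R) :
  controllable A B -> 0 < t -> sym_posdef (partial_gramian A B t).
Proof.
move=> AB t0; split=> [|x]; first exact: partial_gramian_sym.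
rewrite ltNge; apply: contra => qt; apply/eqP.
have t2 : 0 < t / 2 < t by rewrite divr_gt0//= ltr_pdivrMr// ltr_pMr// ltr1n.
have xAB := expmx_moment0 (gramian_form_eq0 t0 qt).
have : (expmx (- (t / 2) *: A))^T *m x = 0.
  apply: (controllable_inj AB) => k.
  by rewrite trmx_mul trmxK xAB.
move/(congr1 (mulmx (invmx (expmx (- (t / 2) *: A))^T))).
by rewrite mulmx0 mulKmx// unitmx_tr expmx_unit.
Qed.

(** * Injectivity of the interpolating flow *)

(** Monotonicity of [psi_hat] in the original coordinates: substitute
    [xi = S^-1 x] with [S] the square root of the Gramian, and move one [S^-1],
    which is symmetric, across the inner product. *)
Lemma psi_hat_monotone_pairing (R : realType) n m (T : R) (A : 'M[R]_n) (B : 'M[R]_(n, m))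
    (psi : 'cV[R]_n -> 'cV[R]_n) (x1 x2 : 'cV[R]_n) :
  sym_posdef (gramian A B T) -> monotone_map (psi_hat T A B psi) ->
  0 <= dotcv (x1 - x2)
    (invmx (gramian A B T) *m (expmx (- T *: A) *m psi x1 - expmx (- T *: A) *m psi x2)).
Proof.
move=> Wpd; have := sqrtmxP Wpd; have := sym_posdef_unit Wpd.
rewrite /psi_hat /monotone_map; set S := sqrtmx _.
move=> Wu [Spd SS] /(_ (invmx S *m x1) (invmx S *m x2)).
have Su := sym_posdef_unit Spd.
have WV : invmx (gramian A B T) = invmx S *m invmx S.
  rewrite -[RHS](mulmxK Wu) -[X in _ *m X *m _]SS !mulmxA.
  by rewrite mulmxKV// mulVmx// mul1mx.
rewrite -mulmxBr !mulKVmx// -!mulmxA -mulmxBr dotcv_mulmxl trmx_inv Spd.1 mulmxA.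
by rewrite WV.
Qed.

(** With [mu = W^-1 dx] and [nu = W^-1 dy], the hypothesis on the displacements
    reads [(W - U) mu = - U nu]; it turns [<dx, W^-1 dy>] into
    [- <mu, (W - U) mu> - <nu, U nu>], a sum of two nonpositive terms. *)
Lemma displacement_eq0 (R : realType) n (U W : 'M[R]_n) (dx dy : 'cV[R]_n) :
  W \in unitmx -> sym_posdef U ->
  (forall x, 0 <= dotcv x ((W - U) *m x)) ->
  dx + U *m (invmx W *m (dy - dx)) = 0 ->
  0 <= dotcv dx (invmx W *m dy) -> dy = 0.
Proof.
move=> Wu [Usym Upos] V0; set mu := invmx W *m dx; set nu := invmx W *m dy.
have -> : dx = W *m mu by rewrite mulKVmx.
rewrite -[dy](mulKVmx Wu) -/nu -mulmxBr mulKmx// mulmxBr => z0.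
have VU : (W - U) *m mu = - (U *m nu).
  by apply/eqP; rewrite -addr_eq0 mulmxBl -z0; apply/eqP; rewrite addrAC addrA.
have -> : dotcv (W *m mu) nu = - dotcv mu ((W - U) *m mu) - dotcv nu (U *m nu).
  have -> : W *m mu = U *m mu + (W - U) *m mu by rewrite -mulmxDl addrC subrK.
  rewrite /dotcv linearD/= mulmxDl mxE -!/(dotcv _ _) dotcv_mulmxl Usym VU.
  by rewrite [dotcv (- _) nu]dotcvC /dotcv !mulmxN !mxE opprK.
move=> h; have nu0 : dotcv nu (U *m nu) <= 0.
  by have := V0 mu; lra.
have [->|/Upos] := eqVneq nu 0; first by rewrite mulmx0.
by rewrite ltNge nu0.
Qed.

(** * The feedback law *)

Section steering.
Context (R : realType) (n m : nat) (T : R) (A : 'M[R]_n) (B : 'M[R]_(n, m))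
  (psi : 'cV[R]_n -> 'cV[R]_n).

Definition steering_costate (x0 : 'cV[R]_n) : 'cV[R]_n :=
  invmx (gramian A B T) *m (expmx (- T *: A) *m psi x0 - x0).

Definition steering_flow (t : R) (x0 : 'cV[R]_n) : 'cV[R]_n :=
  expmx (t *: A) *m (x0 + partial_gramian A B t *m steering_costate x0).

(** The minimum-energy control of the initial state whose trajectory passes
    through [x] at time [t].  The default [0] is used at points that no
    trajectory reaches. *)
Definition steering_feedback (t : R) (x : 'cV[R]_n) : 'cV[R]_m :=
  B^T *m expmx (- t *: A^T) *m
    steering_costate (xget 0 [set x0 | steering_flow t x0 = x]).

Context (T0 : 0 < T) (AB : controllable A B).

Let W := gramian A B T.

Let Wpd : sym_posdef W.
Proof. by rewrite /W -partial_gramianT//; exact: partial_gramian_posdef. Qed.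

Lemma steering_flow0 x0 : steering_flow 0 x0 = x0.
Proof. by rewrite /steering_flow scale0r expmx0 partial_gramian0 mul0mx addr0 mul1mx. Qed.

Lemma steering_flowT x0 : steering_flow T x0 = psi x0.
Proof.
rewrite /steering_flow partial_gramianT// mulKVmx ?sym_posdef_unit//.
by rewrite addrC subrK mulmxA expmxNK mul1mx.
Qed.

Lemma steering_flow_inj t : injective psi -> monotone_map (psi_hat T A B psi) ->
  0 <= t <= T -> injective (steering_flow t).
Proof.
move=> psi_inj mono /andP[t0 tT] x1 x2 /(congr1 (mulmx (invmx (expmx (t *: A))))).
rewrite !mulKmx ?expmx_unit// => /eqP z12.
move: t0; rewrite le_eqVlt => /predU1P[t0|t0].
  by move/eqP: z12; rewrite -t0 partial_gramian0 !mul0mx !addr0.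
apply: psi_inj; apply/eqP; rewrite -subr_eq0; apply/eqP.
apply: (can_inj (mulKmx (expmx_unit A (- T)))); rewrite mulmx0 mulmxBr.
apply: (displacement_eq0 (sym_posdef_unit Wpd) (partial_gramian_posdef AB t0) _ _
  (psi_hat_monotone_pairing x1 x2 Wpd mono)).
  move=> x; have := gramian_form_homo A B x (ltW t0) tT.
  by rewrite (partial_gramianT A B T0) mulmxBl dotcvBr subr_ge0.
move: z12; rewrite /steering_costate -subr_eq0 opprD addrACA -!mulmxBr => /eqP z12.
rewrite -[RHS]z12; congr (_ + _ *m (_ *m _)).
by rewrite mulmxBr !opprD !opprK addrACA.
Qed.

(** Injectivity of the flow identifies the initial state chosen in the feedback
    with [x0], so the closed-loop field agrees with the open-loop one along the
    curve. *)
Lemma steering_flow_trajectory x0 : injective psi -> monotone_map (psi_hat T A B psi) ->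
  closed_loop_trajectory T A B steering_feedback (fun t => steering_flow t x0).
Proof.
move=> psi_inj mono t; rewrite in_itv/= => t0T; apply: is_derive_has_derivative_on.
have -> : steering_feedback t (steering_flow t x0) =
    B^T *m expmx (- t *: A^T) *m steering_costate x0.
  rewrite /steering_feedback; congr (_ *m steering_costate _).
  apply: (steering_flow_inj psi_inj mono t0T).
  exact: (@xgetPex _ 0 [set y | steering_flow t y = _] (ex_intro _ x0 erefl)).
have t1 : -1 < t by case/andP: t0T => t0 _; rewrite (lt_le_trans _ t0)// ltrN10.
have dz : is_derive t (1 : R) (fun s => x0 + partial_gramian A B s *m steering_costate x0)
    (gramian_integrand A B t *m steering_costate x0).
  rewrite -[X in is_derive _ _ _ X]add0r.
  apply: is_deriveD; apply: is_derive_mulmxr; exact: is_derive_partial_gramian.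
apply: is_derive_eq; first exact: is_derive_mulmx (is_derive_expmx A t) dz.
rewrite -comm_expmx /gramian_integrand /steering_flow !mulmxA; congr (_ + _).
by rewrite expmxNK mul1mx.
Qed.

End steering.

Unset Implicit Arguments.
Theorem theorem1 (R : realType) (n m : nat) (T : R)
    (A : 'M[R]_n) (B : 'M[R]_(n, m)) (psi : 'cV[R]_n -> 'cV[R]_n) :
  0 < T ->
  controllable A B ->
  diffeomorphism psi ->
  orientation_preserving psi ->
  monotone_map (psi_hat T A B psi) ->
  sym_posdef (gramian A B T) /\
  exists u : R -> 'cV[R]_n -> 'cV[R]_m, feedback_steers T A B psi u.
Proof.
move=> T0 AB [_ [g [psiK _ _]]] _ mono; split.
  by rewrite -partial_gramianT//; exact: partial_gramian_posdef.
exists (steering_feedback T A B psi) => x0.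
exists (fun t => steering_flow T A B psi t x0).
split; first exact: steering_flow_trajectory (can_inj psiK) mono.
- exact: steering_flow0.
- exact: steering_flowT.
Qed.
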